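(* Consider the system $d\mathbf{x}=(\mathbf{f}(\mathbf{x})+\mathbf{g}(\mathbf{x})\mathbf{u})\,dt+\boldsymbol{\sigma}(\mathbf{x})\,dW$ with $\boldsymbol\sigma(\mathbf{x})=\mathrm{diag}(\sigma_1(\mathbf{x}),\dots,\sigma_n(\mathbf{x}))$. Let $p=u_k$ be one component of $\mathbf{u}$, and assume that there is a diffeomorphism $\boldsymbol\phi:\mathbb{R}^{n+1}\to\mathbb{R}^{n+1}$ of the form $\mathbf{z}=\boldsymbol\phi(\bar{\mathbf{x}})=\boldsymbol\alpha(\mathbf{x})p+\boldsymbol\beta(\mathbf{x})$, $\bar{\mathbf{x}}=[\mathbf{x},p]^T$, which transforms the augmented system into the semi-linear system $$d\mathbf{z}=(\mathbf{A}\mathbf{z}+\mathbf{B}\mathbf{u}')\,dt+\boldsymbol\sigma'(\mathbf{z})\,dW$$ (all in the sense specified in the context). If there exists an unconstrained stochastic control Lyapunov function $\bar V(\mathbf{z})=\mathbf{z}^T\mathbf{P}\mathbf{z}$ for this semi-linear system, then the function $$V(\mathbf{x})=\min_{p}\bar V(\mathbf{x},p),\qquad \bar V(\mathbf{x},p)=\bar V(\mathbf{z})\big|_{\mathbf{z}=\boldsymbol\phi(\bar{\mathbf{x}})},$$ is an unconstrained stochastic control Lyapunov function for the original system $d\mathbf{x}=(\mathbf{f}(\mathbf{x})+\mathbf{g}(\mathbf{x})\mathbf{u})\,dt+\boldsymbol\sigma(\mathbf{x})\,dW$.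
   Context: Here $\mathbf{x}\in\mathbb{R}^n$, $\mathbf{u}\in\mathbb{R}^m$, $W$ is an $n$-dimensional Brownian motion, and $\mathbf{f},\mathbf{g},\boldsymbol\sigma$ are locally Lipschitz. Unconstrained stochastic control Lyapunov function (CLF) for a system $d\mathbf{x}=(f(\mathbf{x})+g(\mathbf{x})\mathbf{u})dt+\sigma(\mathbf{x})dW$: a twice differentiable positive-definite function $V$ such that, for $\mathbf{x}\ne0$, $\mathcal{L}V(\mathbf{x})<0$ whenever $L_gV(\mathbf{x})=0$, where $\mathcal{L}V=L_fV+L_gV\,\mathbf{u}+\frac12\mathrm{tr}(\sigma^T\frac{\partial^2V}{\partial\mathbf{x}^2}\sigma)$, $L_fV=\frac{\partial V}{\partial\mathbf{x}}f$, $L_gV=\frac{\partial V}{\partial\mathbf{x}}g$. (Thus, where $L_gV=0$ and $\mathbf{x}\neq0$, $L_fV+\frac12\mathrm{tr}(\sigma^T\frac{\partial^2V}{\partial\mathbf{x}^2}\sigma)<0$.) For the semi-linear system the roles of $f$, $g$, $\mathbf{u}$, $\sigma$ are played by $\mathbf{A}\mathbf{z}$, $\mathbf{B}$, $\mathbf{u}'$, $\boldsymbol\sigma'$. Augmented system: $d\bar{\mathbf{x}}=[\bar{\mathbf{f}}(\bar{\mathbf{x}})+\bar{\mathbf{g}}(\bar{\mathbf{x}})\bar{\mathbf{u}}]dt+\bar{\boldsymbol\sigma}(\bar{\mathbf{x}})dW$ with $\bar{\mathbf{f}}=\begin{bmatrix}\mathbf{f}(\mathbf{x})\\0\end{bmatrix}$,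 $\bar{\mathbf{g}}=\begin{bmatrix}\mathbf{g}(\mathbf{x})&0\\0&1\end{bmatrix}$, $\bar{\mathbf{u}}=\begin{bmatrix}\mathbf{u}\\ \dot p\end{bmatrix}$, $\bar{\boldsymbol\sigma}=\begin{bmatrix}\boldsymbol\sigma(\mathbf{x})\\0\end{bmatrix}$. Transformation to the semi-linear system means that, with $\bar{\mathbf{x}}=\boldsymbol\phi^{-1}(\mathbf{z})$, $$\mathbf{A}\mathbf{z}+\mathbf{B}\mathbf{u}'=\frac{\partial\boldsymbol\phi}{\partial\bar{\mathbf{x}}}(\bar{\mathbf{f}}+\bar{\mathbf{g}}\bar{\mathbf{u}})+\boldsymbol\tau(\bar{\mathbf{x}}),\qquad \boldsymbol\sigma'(\mathbf{z})=\frac{\partial\boldsymbol\phi}{\partial\bar{\mathbf{x}}}\bar{\boldsymbol\sigma},$$ where $\boldsymbol\tau$ is the vector with entries $\tau_j=\frac12\mathrm{tr}\big(\bar{\boldsymbol\sigma}^T\frac{\partial^2\phi_j}{\partial\bar{\mathbf{x}}^2}\bar{\boldsymbol\sigma}\big)$, $j=1,\dots,n+1$; $\mathbf{A},\mathbf{B}$ are constant matrices; and the control term splits as $\frac{\partial\boldsymbol\phi}{\partial\bar{\mathbf{x}}}\bar{\mathbf{g}}\bar{\mathbf{u}}=\boldsymbol\gamma(\bar{\mathbf{x}})p+\mathbf{B}\mathbf{u}'$, with $\mathbf{u}'=f_u(\bar{\mathbf{x}})[u_1,\dots,u_{k-1},u_{k+1},\dots,u_m,\dot p]^T$, $f_u(\bar{\mathbf{x}})\in\mathbb{R}^{m\times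 m}$ of full rank, so that $\mathbf{A}\mathbf{z}=\frac{\partial\boldsymbol\phi}{\partial\bar{\mathbf{x}}}\bar{\mathbf{f}}+\boldsymbol\tau(\bar{\mathbf{x}})+\boldsymbol\gamma(\bar{\mathbf{x}})p$.
   Formalization: The added assumption is that φ(0,p₀)=0 for some p₀ (the x-part of φ⁻¹(0) is 0), which is equivalent to V(0)=0; without it the claim fails, e.g. dx=(x−1+u)dt, z=(x−1,x−1+p), where V(x)=(x−1)² is not positive definite. *)

(* Defs.v *)
From mathcomp Require Import all_boot all_order all_algebra.
From mathcomp Require Import all_classical all_reals all_analysis.
Set Implicit Arguments.
Unset Strict Implicit.
Unset Printing Implicit Defensive.
Import Order.TTheory GRing.Theory Num.Theory.
Import numFieldNormedType.Exports.
Local Open Scope classical_set_scope.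
Local Open Scope ring_scope.

Section Calculus.
Context {R : realType}.

(* In finite dimension the second clause says exactly that the derivative
   x |-> 'd F x is itself (Frechet) differentiable; second derivatives are
   not required to be continuous. *)
Definition twice_differentiable (V W : normedModType R) (F : V -> W) : Prop :=
  forall x : V, differentiable F x /\ forall v : V, differentiable ('D_v F) x.

Definition locally_lipschitz (V W : normedModType R) (F : V -> W) : Prop :=
  forall x : V, exists2 U : set V, nbhs x U & [lipschitz F y | y in U].

Definition diffeomorphism (V W : normedModType R) (F : V -> W) (G : W -> V) :
    Prop :=
  [/\ cancel F G, cancel G F,
      forall x : V, differentiable F x & forall y : W, differentiable G y].

Definition grad n (V : 'cV[R]_n -> R) (x : 'cV[R]_n) : 'rV[R]_n :=
  \row_j 'D_(delta_mx j 0) V x.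

Definition hessian n (V : 'cV[R]_n -> R) (x : 'cV[R]_n) : 'M[R]_n :=
  \matrix_(i, j) 'D_(delta_mx i 0) ('D_(delta_mx j 0) V) x.

(* The library's jacobian is for row vectors; this is the column version,
   with entry (i, j) the partial derivative of F_i along the j-th axis. *)
Definition jac n m (F : 'cV[R]_n -> 'cV[R]_m) (x : 'cV[R]_n) : 'M[R]_(m, n) :=
  \matrix_(i, j) 'D_(delta_mx j 0) (fun y => F y i 0) x.

(* The second-order (Ito) term (1/2) tr(S^T (d^2V/dx^2) S). *)
Definition ito_term n d (V : 'cV[R]_n -> R) (x : 'cV[R]_n) (S : 'M[R]_(n, d)) :
    R :=
  2^-1 * \tr (S^T *m hessian V x *m S).

End Calculus.

(* The system dx = (drift x + input x u) dt + noise x dW, identified with its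
   coefficients; x in R^n, u in R^m, W a d-dimensional Brownian motion. *)
Record control_sde (R : realType) (n m d : nat) := ControlSDE {
  drift : 'cV[R]_n -> 'cV[R]_n;
  input : 'cV[R]_n -> 'M[R]_(n, m);
  noise : 'cV[R]_n -> 'M[R]_(n, d)
}.

Section Lyapunov.
Context {R : realType} {n m d : nat}.
Implicit Types (S : control_sde R n m d) (V : 'cV[R]_n -> R).

Definition Lf S V (x : 'cV[R]_n) : R := (grad V x *m drift S x) 0 0.

Definition Lg S V (x : 'cV[R]_n) : 'rV[R]_m := grad V x *m input S x.

Definition generator S V (x : 'cV[R]_n) (u : 'cV[R]_m) : R :=
  Lf S V x + (Lg S V x *m u) 0 0 + ito_term V x (noise S x).

Definition positive_definite V : Prop :=
  V 0 = 0 /\ forall x, x != 0 -> 0 < V x.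

Definition stochastic_clf S V : Prop :=
  [/\ twice_differentiable V, positive_definite V &
      forall x, x != 0 -> Lg S V x = 0 ->
        forall u : 'cV[R]_m, generator S V x u < 0].

End Lyapunov.

Definition quadform (R : realType) n (P : 'M[R]_n) (z : 'cV[R]_n) : R :=
  (z^T *m P *m z) 0 0.

(* The augmented state [x; p], and its two components. *)
Definition aug (R : realType) n (x : 'cV[R]_n) (p : R) : 'cV[R]_(n + 1) :=
  col_mx x p%:M.
Definition aug_x (R : realType) n (xb : 'cV[R]_(n + 1)) : 'cV[R]_n :=
  usubmx xb.
Definition aug_p (R : realType) n (xb : 'cV[R]_(n + 1)) : R := dsubmx xb 0 0.

Definition augmented_sde (R : realType) n m d (S : control_sde R n m d) :
    control_sde R (n + 1) (m + 1) d := {|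
  drift := fun xb => col_mx (drift S (aug_x xb)) 0;
  input := fun xb => block_mx (input S (aug_x xb)) 0 0 1%:M;
  noise := fun xb => col_mx (noise S (aug_x xb)) 0
|}.

Definition semilinear_sde (R : realType) n m d (A : 'M[R]_n) (B : 'M[R]_(n, m))
    (sigma' : 'cV[R]_n -> 'M[R]_(n, d)) : control_sde R n m d := {|
  drift := fun z => A *m z;
  input := fun=> B;
  noise := sigma'
|}.

(* [u_1, ..., u_(k-1), u_(k+1), ..., u_m, pdot]^T: the k-th entry of u is
   removed and pdot is put in the last position. *)
Definition reduced_input (R : realType) m (k : 'I_m.+1) (u : 'cV[R]_m.+1)
    (pdot : R) : 'cV[R]_m.+1 :=
  \col_i oapp (fun j : 'I_m => u (lift k j) 0) pdot (unlift ord_max i).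

Definition tau (R : realType) n d (phi : 'cV[R]_n -> 'cV[R]_n)
    (noiseb : 'cV[R]_n -> 'M[R]_(n, d)) (xb : 'cV[R]_n) : 'cV[R]_n :=
  \col_j ito_term (fun y => phi y j 0) xb (noiseb xb).

(* phi_inv is the inverse of phi.  In the augmented system the input u_k is the
   state component p, so the identities range over all u with u_k = p. *)
Definition transforms_to_semilinear (R : realType) n m d
    (S : control_sde R n m.+1 d) (k : 'I_m.+1)
    (phi phi_inv : 'cV[R]_(n + 1) -> 'cV[R]_(n + 1))
    (A : 'M[R]_(n + 1)) (B : 'M[R]_(n + 1, m.+1))
    (sigma' : 'cV[R]_(n + 1) -> 'M[R]_(n + 1, d))
    (gamma : 'cV[R]_(n + 1) -> 'cV[R]_(n + 1))
    (fu : 'cV[R]_(n + 1) -> 'M[R]_m.+1) : Prop :=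
  let Sb := augmented_sde S in
  forall z : 'cV[R]_(n + 1), let xb := phi_inv z in
    [/\ \rank (fu xb) = m.+1,
        sigma' z = jac phi xb *m noise Sb xb &
        forall (u : 'cV[R]_m.+1) (pdot : R), u k 0 = aug_p xb ->
          let ub := col_mx u pdot%:M in
          let u' := fu xb *m reduced_input k u pdot in
          A *m z + B *m u' =
            jac phi xb *m (drift Sb xb + input Sb xb *m ub)
              + tau phi (noise Sb) xb
          /\ jac phi xb *m (input Sb xb *m ub) =
               aug_p xb *: gamma xb + B *m u'].

(* Main.v *)
Require Import Defs.
From mathcomp Require Import all_boot all_order all_algebra.
From mathcomp Require Import all_classical all_reals all_analysis.
From mathcomp Require Import ring.
Import Order.TTheory GRing.Theory Num.Theory.
Import numFieldNormedType.Exports.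
Local Open Scope classical_set_scope.
Local Open Scope ring_scope.
Set Implicit Arguments.
Unset Strict Implicit.
Unset Printing Implicit Defensive.

(* Let q z = z^T P z.  Since phi is injective and affine in p, alpha never
   vanishes, so q (phi (x, p)) = V x + q (alpha x) * (p - pmin x) ^ 2 with
   q (alpha x) > 0.  Comparing derivatives at p = pmin x, where the square
   vanishes, the gradient of q o phi is (grad V, 0) and each diagonal second
   derivative of V is at most that of q o phi; as sigma is diagonal, the Ito
   terms compare in the same way.
   If L_g V x = 0, the splitting of the control term for arbitrary reduced
   inputs and the invertibility of f_u force (grad q z) B = 0 at
   z = phi (x, pmin x).  The Lyapunov inequality at z, rewritten with the
   second-order chain rule for q o phi (tau is its Ito correction), then bounds
   the generator of V at x. *)

(** * Closure rules for twice differentiable functions *)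

Section LinearDerivatives.
Context {R : realType} {U W : normedModType R}.
Implicit Types F G : U -> W.

Lemma twice_differentiableD F G :
  twice_differentiable F -> twice_differentiable G ->
  twice_differentiable (fun x => F x + G x).
Proof.
move=> dF dG x; split=> [|v]; first exact: differentiableD (dF x).1 (dG x).1.
rewrite (_ : 'D_v _ = 'D_v F + 'D_v G).
  exact: differentiableD ((dF x).2 v) ((dG x).2 v).
apply/funext => y.
by rewrite (deriveD (diff_derivable (dF y).1) (diff_derivable (dG y).1)).
Qed.

Lemma twice_differentiableN F :
  twice_differentiable F -> twice_differentiable (fun x => - F x).
Proof.
move=> dF x; split=> [|v]; first exact: differentiableN (dF x).1.
rewrite (_ : 'D_v _ = - 'D_v F); first exact: differentiableN ((dF x).2 v).
by apply/funext => y; rewrite (deriveN (diff_derivable (dF y).1)).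
Qed.

Lemma twice_differentiable_cst (a : W) : twice_differentiable (cst a : U -> W).
Proof.
move=> x; split=> [|v]; first exact: differentiable_cst.
rewrite (_ : 'D_v _ = cst 0); first exact: differentiable_cst.
by apply/funext => y; rewrite derive_cst.
Qed.

End LinearDerivatives.

Section ScalarDerivatives.
Context {R : realType} {U : normedModType R}.
Implicit Types F G : U -> R.

Lemma derive_mul F G v x : differentiable F x -> differentiable G x ->
  'D_v (fun y => F y * G y) x = 'D_v F x * G x + F x * 'D_v G x.
Proof.
move=> dF dG; rewrite (deriveM (diff_derivable dF) (diff_derivable dG)).
by rewrite addrC mulrC.
Qed.

Lemma differentiable_mul F G x : differentiable F x -> differentiable G x ->
  differentiable (fun y => F y * G y) x.
Proof. exact: differentiableM. Qed.

Lemma twice_differentiable_mul F G :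
  twice_differentiable F -> twice_differentiable G ->
  twice_differentiable (fun x => F x * G x).
Proof.
move=> dF dG x; have [dFx ddFx] := dF x; have [dGx ddGx] := dG x.
split=> [|v]; first exact: differentiable_mul.
rewrite (_ : 'D_v _ = fun y => 'D_v F y * G y + F y * 'D_v G y).
  by apply: differentiableD; apply: differentiable_mul.
by apply/funext => y; rewrite derive_mul//; [exact: (dF y).1|exact: (dG y).1].
Qed.

Lemma twice_differentiable_inv F : (forall x, F x != 0) ->
  twice_differentiable F -> twice_differentiable (fun x => (F x)^-1).
Proof.
move=> F0 dF x; have [dFx ddFx] := dF x; have dV := differentiableV dFx (F0 x).
split=> [//|v].
(* The derivative of the inverse is written as a product of differentiable functions, so that the
   product rule alone closes the second-order claim. *)
rewrite (_ : 'D_v _ = fun y => -1 * ((F y)^-1 * (F y)^-1 * 'D_v F y)).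
  apply: differentiable_mul; first exact: differentiable_cst.
  by apply: differentiable_mul => //; exact: differentiable_mul.
apply/funext => y; rewrite deriveV//; last exact: diff_derivable (dF y).1.
by rewrite /GRing.scale/= expr2 invfM mulN1r mulNr.
Qed.

Lemma derive2_mul F G u v x : twice_differentiable F -> twice_differentiable G ->
  'D_u ('D_v (fun y => F y * G y)) x =
  'D_u ('D_v F) x * G x + 'D_v F x * 'D_u G x +
  ('D_u F x * 'D_v G x + F x * 'D_u ('D_v G) x).
Proof.
move=> dF dG; have [dFx ddFx] := dF x; have [dGx ddGx] := dG x.
rewrite (_ : 'D_v _ = fun y => 'D_v F y * G y + F y * 'D_v G y); last first.
  by apply/funext => y; rewrite derive_mul//; [exact: (dF y).1|exact: (dG y).1].
rewrite deriveD ?derive_mul//; apply: diff_derivable; exact: differentiable_mul.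
Qed.

End ScalarDerivatives.

(** With equal arguments this is convertible to [quadform], so Leibniz rules stated for two separate
    arguments apply directly to [quadform P] and to [quadform P \o phi]. *)
Definition bform (R : pzRingType) n (P : 'M[R]_n) (u w : 'cV[R]_n) : R :=
  (u^T *m P *m w) 0 0.

Lemma bformE (R : comPzRingType) n (P : 'M[R]_n) u w :
  bform P u w = \sum_(i < n) \sum_(j < n) P i j * (u i 0 * w j 0).
Proof.
rewrite /bform mxE exchange_big; apply: eq_bigr => j _.
rewrite mxE mulr_suml; apply: eq_bigr => i _; rewrite mxE; ring.
Qed.

(** * Leibniz rules for bilinear forms of vector-valued functions *)

Section VectorDerivatives.
Context {R : realType} {U : normedModType R} {n : nat}.
Implicit Types (F G : U -> 'cV[R]_n) (P : 'M[R]_n).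

Lemma differentiable_component F i x : differentiable F x ->
  differentiable (fun y => F y i 0 : R) x.
Proof.
move=> dF.
apply: (@differentiable_comp _ _ _ _ F (fun N : 'cV[R]_n => N i 0 : R)) => //.
exact: differentiable_coord.
Qed.

Lemma derive_component F i v x : differentiable F x ->
  'D_v (fun y => F y i 0 : R) x = 'D_v F x i 0.
Proof. by move=> dF; rewrite derive_mx ?mxE//; exact: diff_derivable. Qed.

Lemma derive2_component F i u v x : twice_differentiable F ->
  'D_u ('D_v (fun y => F y i 0 : R)) x = 'D_u ('D_v F) x i 0.
Proof.
move=> dF; rewrite -derive_component; last exact: (dF x).2.
by congr ('D_u _ x); apply/funext => y; rewrite derive_component//; exact: (dF y).1.
Qed.

Lemma bform_fun_sum P F G : (fun y => bform P (F y) (G y)) =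
  \sum_(i < n) \sum_(j < n) (fun y => P i j * (F y i 0 * G y j 0)).
Proof.
apply/funext => y; rewrite bformE fct_sumE; apply: eq_bigr => i _.
by rewrite fct_sumE.
Qed.

Lemma differentiable_bform P F G x : differentiable F x -> differentiable G x ->
  differentiable (fun y => bform P (F y) (G y)) x.
Proof.
move=> dF dG; rewrite bform_fun_sum.
apply: differentiable_sum => i; apply: differentiable_sum => j.
apply: differentiable_mul; first exact: differentiable_cst.
by apply: differentiable_mul; exact: differentiable_component.
Qed.

Lemma derive_bform P F G v x : differentiable F x -> differentiable G x ->
  'D_v (fun y => bform P (F y) (G y)) x =
  bform P ('D_v F x) (G x) + bform P (F x) ('D_v G x).
Proof.
move=> dF dG; rewrite bform_fun_sum.
have dFG i j : differentiable (fun y => F y i 0 * G y j 0 : R) x.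
  by apply: differentiable_mul; exact: differentiable_component.
have dP i j : differentiable (fun y => P i j * (F y i 0 * G y j 0) : R) x.
  by apply: differentiable_mul => //; exact: differentiable_cst.
rewrite derive_sum => [|i]; last first.
  by apply: diff_derivable; apply: differentiable_sum => j.
rewrite !bformE -big_split; apply: eq_bigr => i _.
rewrite derive_sum => [|j]; last exact: diff_derivable.
rewrite -big_split; apply: eq_bigr => j _ /=.
rewrite (derive_mul _ (differentiable_cst _ _) (dFG i j)).
rewrite derive_cst derive_mul ?derive_component//;
  try exact: differentiable_component.
by rewrite mul0r add0r mulrDr.
Qed.

Lemma derive_bform_fun P F G v : twice_differentiable F -> twice_differentiable G ->
  'D_v (fun y => bform P (F y) (G y)) =
  fun x => bform P ('D_v F x) (G x) + bform P (F x) ('D_v G x).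
Proof.
move=> dF dG; apply/funext => y.
exact: derive_bform (dF y).1 (dG y).1.
Qed.

Lemma twice_differentiable_bform P F G :
  twice_differentiable F -> twice_differentiable G ->
  twice_differentiable (fun y => bform P (F y) (G y)).
Proof.
move=> dF dG x; have [dFx ddFx] := dF x; have [dGx ddGx] := dG x.
split=> [|v]; first exact: differentiable_bform.
by rewrite derive_bform_fun//; apply: differentiableD; exact: differentiable_bform.
Qed.

Lemma derive2_bform P F G u v x : twice_differentiable F -> twice_differentiable G ->
  'D_u ('D_v (fun y => bform P (F y) (G y))) x =
  bform P ('D_u ('D_v F) x) (G x) + bform P ('D_v F x) ('D_u G x) +
  (bform P ('D_u F x) ('D_v G x) + bform P (F x) ('D_u ('D_v G) x)).
Proof.
move=> dF dG; have [dFx ddFx] := dF x; have [dGx ddGx] := dG x.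
rewrite derive_bform_fun// deriveD ?derive_bform//;
  apply: diff_derivable; exact: differentiable_bform.
Qed.

End VectorDerivatives.

(** * Quadratic forms, their composites with a map, and their minima on lines *)

Section QuadraticForms.
Context {R : realType}.

Lemma mx_entry m n (A : 'M[R]_(m, n)) i j :
  A i j = ((delta_mx i 0 : 'cV_m)^T *m A *m (delta_mx j 0 : 'cV_n)) 0 0.
Proof. by rewrite trmx_delta -rowE -colE !mxE. Qed.

(** A one-by-one matrix equals its transpose. [P] is not assumed symmetric, so every derivative of
    [quadform P] shows [P + P^T] instead of twice [P]. *)
Lemma bform_symm n (P : 'M[R]_n) u w :
  bform P u w + bform P w u = (w^T *m (P + P^T) *m u) 0 0.
Proof.
rewrite mulmxDr mulmxDl [RHS]mxE addrC; congr (_ + _).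
by rewrite -[in RHS]trace_mx11 -mxtrace_tr !trmx_mul !trmxK mulmxA trace_mx11.
Qed.

Lemma twice_differentiable_id (U : normedModType R) :
  twice_differentiable (@id U).
Proof.
move=> x; split=> [|v]; first exact: ex_diff.
rewrite (_ : 'D_v _ = cst v); first exact: differentiable_cst.
by apply/funext => y; rewrite derive_id.
Qed.

Lemma grad_quadform n (P : 'M[R]_n) z : grad (quadform P) z = z^T *m (P + P^T).
Proof.
apply/rowP => j; rewrite mxE.
have did := (twice_differentiable_id z).1.
rewrite (derive_bform _ _ did did).
by rewrite !derive_id bform_symm -colE mxE.
Qed.

Lemma hessian_quadform n (P : 'M[R]_n) z : hessian (quadform P) z = P + P^T.
Proof.
have dd (u v : 'cV[R]_n) : 'D_u ('D_v id) z = 0.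
  rewrite (_ : 'D_v _ = cst v) ?derive_cst//.
  by apply/funext => y; rewrite derive_id.
apply/matrixP => i j; rewrite mxE.
have did := @twice_differentiable_id 'cV[R]_n.
rewrite (derive2_bform _ _ _ _ did did).
rewrite !derive_id !dd [in LHS]/bform trmx0 !mul0mx mulmx0 mxE add0r addr0.
by rewrite bform_symm -mx_entry.
Qed.

Section Composition.
Context {n N : nat}.
Variables (P : 'M[R]_N) (phi : 'cV[R]_n -> 'cV[R]_N).
Hypothesis dphi : twice_differentiable phi.

Lemma jac_delta x j : jac phi x *m delta_mx j 0 = 'D_(delta_mx j 0) phi x.
Proof.
rewrite -colE; apply/colP => i; rewrite !mxE.
exact: derive_component (dphi x).1.
Qed.

Lemma grad_quadform_comp x :
  grad (quadform P \o phi) x = grad (quadform P) (phi x) *m jac phi x.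
Proof.
apply/rowP => j; rewrite mxE (derive_bform _ _ (dphi x).1 (dphi x).1).
by rewrite bform_symm -jac_delta mulmxA -colE mxE grad_quadform.
Qed.

Lemma hessian_quadform_comp x : hessian (quadform P \o phi) x =
  \sum_i grad (quadform P) (phi x) 0 i *: hessian (fun y => phi y i 0) x +
  (jac phi x)^T *m hessian (quadform P) (phi x) *m jac phi x.
Proof.
apply/matrixP => i j; rewrite mxE (derive2_bform _ _ _ _ dphi dphi).
(* The four Leibniz terms are regrouped in two pairs, second derivative against value and first
   derivative against first derivative; [bform_symm] then collapses each pair. *)
rewrite [X in _ + X]addrC addrACA !bform_symm -!jac_delta.
rewrite mxE grad_quadform hessian_quadform [RHS]mxE; congr (_ + _).
  rewrite summxE; apply: eq_bigr => k _; by rewrite !mxE derive2_component.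
by rewrite [RHS]mx_entry trmx_mul !mulmxA.
Qed.

(** This is the second-order part of Ito's formula: the trace of the chain-rule Hessian splits, and
    the column paired with the gradient is convertible to [tau phi noise x]. *)
Lemma ito_term_quadform_comp d x (noise : 'cV[R]_n -> 'M[R]_(n, d)) :
  ito_term (quadform P \o phi) x (noise x) =
  (grad (quadform P) (phi x) *m
     \col_j ito_term (fun y => phi y j 0) x (noise x)) 0 0
  + ito_term (quadform P) (phi x) (jac phi x *m noise x).
Proof.
rewrite /ito_term hessian_quadform_comp mulmxDr mulmxDl mxtraceD mulrDr.
congr (_ + _); last by rewrite trmx_mul !mulmxA.
rewrite mulmx_sumr mulmx_suml raddf_sum mulr_sumr mxE; apply: eq_bigr => i _.
by rewrite -scalemxAr -scalemxAl /= mxtraceZ mulrCA [X in _ = _ * X]mxE.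
Qed.

End Composition.

(** The vertex of the parabola [p |-> quadform P (p *: a + b)], minus the linear coefficient over
    twice the leading one; meaningful when [quadform P a] is nonzero. *)
Definition line_argmin n (P : 'M[R]_n) (a b : 'cV[R]_n) : R :=
  - (bform P a b + bform P b a) * (2 * quadform P a)^-1.

Definition line_min n (P : 'M[R]_n) (a b : 'cV[R]_n) : R :=
  quadform P (line_argmin P a b *: a + b).

Lemma quadform_line n (P : 'M[R]_n) (a b : 'cV[R]_n) (p : R) :
  quadform P (p *: a + b) =
  p ^+ 2 * quadform P a + p * (bform P a b + bform P b a) + quadform P b.
Proof.
rewrite /quadform /bform [(_ + _)^T]linearD linearZ/= !mulmxDl !mulmxDr.
by rewrite -!scalemxAl -!scalemxAr !mxE; ring.
Qed.

Lemma quadform_line_min n (P : 'M[R]_n) (a b : 'cV[R]_n) (p : R) :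
  quadform P a != 0 -> quadform P (p *: a + b) =
  line_min P a b +
  quadform P a * ((p - line_argmin P a b) * (p - line_argmin P a b)).
Proof.
by move=> a0; rewrite /line_min !quadform_line /line_argmin; field.
Qed.

End QuadraticForms.

(** * Derivatives at a zero of a squared term *)

Section SquareZero.
Context {R : realType} {U : normedModType R}.
Variables (V a w : U -> R) (x : U).
Hypotheses (dV : twice_differentiable V) (da : twice_differentiable a).
Hypotheses (dw : twice_differentiable w) (wx : w x = 0).

Lemma derive_add_square v :
  'D_v (fun y => V y + a y * (w y * w y)) x = 'D_v V x.
Proof.
have dww := twice_differentiable_mul dw dw.
rewrite deriveD; last first.
- exact: diff_derivable (twice_differentiable_mul da dww x).1.
- exact: diff_derivable (dV x).1.
rewrite (derive_mul _ (da x).1 (dww x).1) (derive_mul _ (dw x).1 (dw x).1) wx.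
by rewrite !(mul0r, mulr0, addr0).
Qed.

(** Each term of the twice applied product rule keeps a factor [w x = 0], except the one in which
    both copies of [w] are differentiated. *)
Lemma derive2_add_square v :
  'D_v ('D_v (fun y => V y + a y * (w y * w y))) x =
  'D_v ('D_v V) x + 2 * a x * 'D_v w x ^+ 2.
Proof.
have dww := twice_differentiable_mul dw dw.
have daww := twice_differentiable_mul da dww.
rewrite (_ : 'D_v _ = 'D_v V + 'D_v (fun y => a y * (w y * w y))); last first.
  apply/funext => y; rewrite deriveD//; apply: diff_derivable.
  - exact: (dV y).1.
  - exact: (daww y).1.
rewrite deriveD; last first.
- exact: diff_derivable ((daww x).2 v).
- exact: diff_derivable ((dV x).2 v).
rewrite derive2_mul// derive2_mul// (derive_mul _ (dw x).1 (dw x).1) wx.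
ring.
Qed.

End SquareZero.

(** * Derivatives along the components of the augmented state *)

Section Augmentation.
Context {R : realType} {n : nat}.

(** The two difference quotients are the same function of [h], so no differentiability of [F] has to
    be assumed. *)
Lemma derive_aug (W : normedModType R) (F : 'cV[R]_(n + 1) -> W) v x p :
  'D_(col_mx v 0) F (aug x p) = 'D_v (fun y => F (aug y p)) x.
Proof.
have E : (fun h : R => h^-1 *:
    ((F \o shift (aug x p)) (h *: (col_mx v 0 : 'cV_(n + 1))) - F (aug x p))) =
  (fun h => h^-1 *: (((fun y => F (aug y p)) \o shift x) (h *: v) - F (aug x p))).
  apply/funext => h /=; congr (_ *: (F _ - _)).
  by rewrite /shift/= /aug scale_col_mx scaler0 add_col_mx add0r.
by rewrite /derive E.
Qed.

Lemma derive_aug_p (W : normedModType R) (F : 'cV[R]_(n + 1) -> W) x p :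
  'D_(col_mx 0 1%:M) F (aug x p) = 'D_1 (fun t : R => F (aug x t)) p.
Proof.
have E : (fun h : R => h^-1 *: ((F \o shift (aug x p))
    (h *: (col_mx 0 1%:M : 'cV_(n + 1))) - F (aug x p))) =
  (fun h => h^-1 *: (((fun t => F (aug x t)) \o shift p) (h *: 1) - F (aug x p))).
  apply/funext => h /=; congr (_ *: (F _ - _)).
  rewrite /shift/= /aug scale_col_mx scaler0 add_col_mx add0r.
  by rewrite scale_scalar_mx -raddfD.
by rewrite /derive E.
Qed.

(** This displays [aug y p] as an affine function of the coordinates of [y], from which its
    differentiability follows. *)
Lemma aug_sum (y : 'cV[R]_n) p : aug y p =
  \sum_(i < n) y i 0 *: (delta_mx (lshift 1 i) 0 : 'cV_(n + 1)) + aug 0 p.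
Proof.
apply/colP => i; rewrite !mxE summxE; case: splitP => j ij; rewrite mxE; last first.
  rewrite big1 ?add0r// => l _; rewrite !mxE; case: eqP => [il|]; rewrite ?mulr0//.
  (* The index of [lshift 1 l] is below [n], whereas [i] is the last row, of index at least [n]. *)
  have := ltn_ord l.
  by rewrite -[X in (X < _)%N]/(lshift 1 l : nat) -il ij ltnNge leq_addr.
rewrite addr0 (bigD1 j)//= big1 ?addr0 => [|l lj]; rewrite !mxE.
  by rewrite (_ : i = lshift 1 j) ?eqxx ?mulr1//; exact: val_inj.
case: eqP => [il|]; rewrite ?mulr0//.
by case/eqP: lj; apply: val_inj; rewrite /= -ij il.
Qed.

Lemma differentiable_aug p x : differentiable (fun y : 'cV[R]_n => aug y p) x.
Proof.
have -> : (fun y : 'cV[R]_n => aug y p) =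
    (\sum_(i < n) (fun y : 'cV[R]_n =>
      y i 0 *: (delta_mx (lshift 1 i) 0 : 'cV[R]_(n + 1))))
    + cst (aug 0 p).
  by apply/funext => y; rewrite aug_sum; congr (_ + _); rewrite fct_sumE.
apply: differentiableD; last exact: differentiable_cst.
apply: differentiable_sum => i; apply: differentiableZl; exact: differentiable_coord.
Qed.

Lemma derive_aug_fun (W : normedModType R) (F : 'cV[R]_(n + 1) -> W) v p :
  'D_v (fun y : 'cV[R]_n => F (aug y p)) =
  (fun y => 'D_(col_mx v 0 : 'cV_(n + 1)) F (aug y p)).
Proof. by apply: funext => y; rewrite derive_aug. Qed.

Lemma differentiable_comp_aug (W : normedModType R) (F : 'cV[R]_(n + 1) -> W) p x :
  differentiable F (aug x p) -> differentiable (fun y => F (aug y p)) x.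
Proof. exact: (differentiable_comp (differentiable_aug p x)). Qed.

Lemma twice_differentiable_aug (W : normedModType R) (F : 'cV[R]_(n + 1) -> W) p :
  twice_differentiable F -> twice_differentiable (fun y => F (aug y p)).
Proof.
move=> dF x; split=> [|v]; first exact: differentiable_comp_aug (dF _).1.
by rewrite derive_aug_fun; exact: differentiable_comp_aug ((dF _).2 _).
Qed.

Lemma derive2_aug (W : normedModType R) (F : 'cV[R]_(n + 1) -> W) u v x p :
  'D_(col_mx u 0) ('D_(col_mx v 0) F) (aug x p) =
  'D_u ('D_v (fun y => F (aug y p))) x.
Proof. by rewrite derive_aug derive_aug_fun. Qed.

End Augmentation.

(** * Ito traces for diagonal noise, and surjectivity of the reduced input *)

Section NoiseTrace.
Context {R : realType} {n : nat}.

Lemma trace_diag_congr (d : 'rV[R]_n) (H : 'M[R]_n) :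
  \tr ((diag_mx d)^T *m H *m diag_mx d) = \sum_i d 0 i ^+ 2 * H i i.
Proof.
apply: eq_bigr => i _; rewrite tr_diag_mx mul_mx_diag mul_diag_mx !mxE; ring.
Qed.

(** The zero noise row of [p] selects the upper left block of [H], and diagonality leaves only its
    diagonal entries. Comparing pure second derivatives is therefore enough to compare Ito terms. *)
Lemma trace_augmented_congr (d : 'rV[R]_n) (H : 'M[R]_(n + 1)) :
  \tr ((col_mx (diag_mx d) (0 : 'M[R]_(1, n)))^T *m H *m col_mx (diag_mx d) 0) =
  \sum_i d 0 i ^+ 2 * H (lshift 1 i) (lshift 1 i).
Proof.
rewrite tr_col_mx -{1}(submxK H) mul_row_block mul_row_col trmx0.
rewrite !(mul0mx, mulmx0, addr0) trace_diag_congr.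
by apply: eq_bigr => i _; rewrite !mxE.
Qed.

End NoiseTrace.

Lemma reduced_input_surj (R : realType) m (k : 'I_m.+1) (p : R) (w : 'cV[R]_m.+1) :
  exists u : 'cV[R]_m.+1, exists pdot : R, u k 0 = p /\ reduced_input k u pdot = w.
Proof.
(* The entries of [w] other than the last are spread around position [k], which receives [p]; the
   last entry serves as [pdot]. *)
exists (\col_j oapp (fun i : 'I_m => w (lift ord_max i) 0) p (unlift k j)).
exists (w ord_max 0).
split; first by rewrite mxE unlift_none.
apply/colP => i; rewrite mxE; case: unliftP => [j ->|->] //=.
by rewrite mxE liftK.
Qed.

Lemma aug_splitK (R : realType) n (xb : 'cV[R]_(n + 1)) :
  aug (aug_x xb) (aug_p xb) = xb.
Proof. by rewrite /aug /aug_x /aug_p -mx11_scalar vsubmxK. Qed.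

Lemma quadform0 (R : realType) n (P : 'M[R]_n) : quadform P 0 = 0.
Proof. by rewrite /quadform mulmx0 mxE. Qed.

(** * Minimization over the input component p *)

Section Minimization.
Context {R : realType} {n : nat}.
Variables (phi phi_inv : 'cV[R]_(n + 1) -> 'cV[R]_(n + 1)).
Variables alpha beta : 'cV[R]_n -> 'cV[R]_(n + 1).
Hypotheses (phiK : cancel phi phi_inv) (phi_invK : cancel phi_inv phi).
Hypothesis dphi : twice_differentiable phi.
Hypothesis phi_affine : forall x p, phi (aug x p) = p *: alpha x + beta x.
Hypothesis phi_origin : aug_x (phi_inv 0) = 0.
Variable P : 'M[R]_(n + 1).
Hypothesis P_pd : positive_definite (quadform P).

Definition min_state x := line_min P (alpha x) (beta x).
Definition argmin_state x := line_argmin P (alpha x) (beta x).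
Local Notation V := min_state.
Local Notation pmin := argmin_state.

(** Regularity of [alpha] and [beta] is inherited from [phi] through its values at [p = 1] and
    [p = 0]. *)
Lemma alphaE : alpha = fun x => phi (aug x 1) - phi (aug x 0).
Proof. by apply/funext => x; rewrite !phi_affine scale1r scale0r add0r addrK. Qed.

Lemma betaE : beta = fun x => phi (aug x 0).
Proof. by apply/funext => x; rewrite phi_affine scale0r add0r. Qed.

(** If [alpha x] were zero, [phi (aug x p)] would not depend on [p], against injectivity of
    [phi]. *)
Lemma alpha_gt0 x : 0 < quadform P (alpha x).
Proof.
apply: P_pd.2; apply/eqP => a0.
have /(can_inj phiK)/eq_col_mx[_ /matrixP/(_ 0 0)] : phi (aug x 1) = phi (aug x 0).
  by rewrite !phi_affine a0 !scaler0.
by rewrite !mxE/= => /eqP; rewrite oner_eq0.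
Qed.

Lemma quadform_phi_aug x p : quadform P (phi (aug x p)) =
  V x + quadform P (alpha x) * ((p - pmin x) * (p - pmin x)).
Proof.
by rewrite phi_affine; apply: quadform_line_min; rewrite gt_eqF ?alpha_gt0.
Qed.

Lemma quadform_phi_aug_fun p :
  (fun x => (quadform P \o phi) (aug x p)) =
  (fun x => V x + quadform P (alpha x) * ((p - pmin x) * (p - pmin x))).
Proof. by apply/funext => x; exact: quadform_phi_aug. Qed.

Lemma min_stateE x : V x = quadform P (phi (aug x (pmin x))).
Proof. by rewrite quadform_phi_aug subrr mul0r mulr0 addr0. Qed.

Lemma min_state_le x p : V x <= quadform P (phi (aug x p)).
Proof.
by rewrite quadform_phi_aug lerDl -expr2 mulr_ge0 ?sqr_ge0// ltW// alpha_gt0.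
Qed.

Lemma twice_differentiable_alpha : twice_differentiable alpha.
Proof.
rewrite alphaE; apply: twice_differentiableD; last apply: twice_differentiableN;
  exact: twice_differentiable_aug.
Qed.

Lemma twice_differentiable_beta : twice_differentiable beta.
Proof. by rewrite betaE; exact: twice_differentiable_aug. Qed.

Lemma twice_differentiable_quadform_alpha :
  twice_differentiable (fun x => quadform P (alpha x)).
Proof. by apply: twice_differentiable_bform; exact: twice_differentiable_alpha. Qed.

Lemma twice_differentiable_argmin : twice_differentiable pmin.
Proof.
have da := twice_differentiable_alpha; have db := twice_differentiable_beta.
apply: twice_differentiable_mul.
  apply: twice_differentiableN.
  by apply: twice_differentiableD; exact: twice_differentiable_bform.
apply: twice_differentiable_inv => [x|].
  by rewrite mulf_neq0// gt_eqF// alpha_gt0.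
apply: twice_differentiable_mul; first exact: twice_differentiable_cst.
exact: twice_differentiable_quadform_alpha.
Qed.

Lemma twice_differentiable_min : twice_differentiable V.
Proof.
(* The completed square is read at [p = 0], where [phi (aug x 0)] is [beta x], and solved for
   [V]. *)
rewrite (_ : V = fun x =>
  quadform P (beta x) - quadform P (alpha x) * (pmin x * pmin x)).
  have dp := twice_differentiable_argmin.
  apply: twice_differentiableD.
    apply: twice_differentiable_bform; exact: twice_differentiable_beta.
  apply: twice_differentiableN; apply: twice_differentiable_mul.
    exact: twice_differentiable_quadform_alpha.
  exact: twice_differentiable_mul.
by apply/funext => x; rewrite [in RHS]betaE quadform_phi_aug sub0r mulrNN addrK.
Qed.

(** The only state that [phi] sends to the origin has [x]-part zero, by [phi_origin]. This is what
    puts the zero of [V] at the origin and nowhere else. *)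
Lemma phi_aug_neq0 x p : x != 0 -> phi (aug x p) != 0.
Proof.
apply: contra_neq => z0.
by rewrite -phi_origin -z0 phiK /aug_x col_mxKu.
Qed.

Lemma positive_definite_min : positive_definite V.
Proof.
split=> [|x x0]; last by rewrite min_stateE; apply: P_pd.2; exact: phi_aug_neq0.
have qge0 z : 0 <= quadform P z.
  by have [->|/P_pd.2/ltW//] := eqVneq z 0; rewrite quadform0.
apply/le_anti; rewrite [X in _ && (_ <= X)]min_stateE qge0 andbT.
(* The [p]-part of [phi_inv 0] is a competitor at [x = 0] with value zero. *)
have := min_state_le 0 (aug_p (phi_inv 0)).
by rewrite -[in X in aug X]phi_origin aug_splitK phi_invK quadform0.
Qed.

Lemma twice_differentiable_gap p : twice_differentiable (fun y => p - pmin y).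
Proof.
apply: twice_differentiableD; first exact: twice_differentiable_cst.
by apply: twice_differentiableN; exact: twice_differentiable_argmin.
Qed.

Local Notation xmin x := (aug x (pmin x)).

Lemma grad_min x : grad (quadform P \o phi) (xmin x) = row_mx (grad V x) 0.
Proof.
apply/rowP => j; rewrite [LHS]mxE; have [{}j ->|{}j ->] := split_ordP j.
  (* In an [x]-direction [p] stays frozen at [pmin x] while the base point [y] moves; the squared
     gap [pmin x - pmin y] vanishes at [y = x]. *)
  rewrite delta_mx_ushift row_mxEl mxE derive_aug quadform_phi_aug_fun.
  rewrite (derive_add_square twice_differentiable_min
    twice_differentiable_quadform_alpha (twice_differentiable_gap _))//.
  by rewrite subrr.
rewrite delta_mx_dshift row_mxEr mxE ord1.
rewrite (_ : delta_mx 0 0 = 1%:M); last first.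
  by apply/matrixP => a b; rewrite !mxE !ord1.
rewrite derive_aug_p; under eq_fun do rewrite /= quadform_phi_aug.
(* In the [p]-direction the same lemma is used on the real line, with [V x] and the leading
   coefficient as constants. *)
rewrite (derive_add_square (V := cst (V x)) (a := cst (quadform P (alpha x)))
  (w := fun t => t - pmin x)) ?subrr ?derive_cst//.
- exact: twice_differentiable_cst.
- exact: twice_differentiable_cst.
apply: twice_differentiableD; last exact: twice_differentiable_cst.
exact: twice_differentiable_id.
Qed.

(** The right side exceeds the left by twice [quadform P (alpha x)] times the square of the [i]-th
    partial derivative of [pmin], the cost of not letting [p] follow the minimizer. *)
Lemma hessian_min_le x i :
  hessian V x i i <= hessian (quadform P \o phi) (xmin x) (lshift 1 i) (lshift 1 i).
Proof.
rewrite !mxE delta_mx_ushift derive2_aug quadform_phi_aug_fun.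
rewrite (derive2_add_square twice_differentiable_min
  twice_differentiable_quadform_alpha (twice_differentiable_gap _)) ?subrr//.
by rewrite lerDl mulr_ge0 ?sqr_ge0// mulr_ge0// ltW// alpha_gt0.
Qed.

Lemma ito_term_min_le x (d : 'rV[R]_n) :
  ito_term V x (diag_mx d) <=
  ito_term (quadform P \o phi) (xmin x) (col_mx (diag_mx d) (0 : 'M[R]_(1, n))).
Proof.
rewrite /ito_term trace_diag_congr trace_augmented_congr ler_pM2l ?invr_gt0//.
by apply: ler_sum => i _; rewrite ler_wpM2l ?sqr_ge0// hessian_min_le.
Qed.

End Minimization.

(** * The Lyapunov property of the minimum *)

Theorem proposition2 (R : realType) (n m : nat)
  (f : 'cV[R]_n -> 'cV[R]_n) (g : 'cV[R]_n -> 'M[R]_(n, m.+1))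
  (sigma : 'I_n -> 'cV[R]_n -> R)
  (hf : locally_lipschitz f) (hg : locally_lipschitz g)
  (hsigma : locally_lipschitz (fun x => diag_mx (\row_i sigma i x)))
  (k : 'I_m.+1)
  (phi phi_inv : 'cV[R]_(n + 1) -> 'cV[R]_(n + 1))
  (alpha beta : 'cV[R]_n -> 'cV[R]_(n + 1))
  (hphi : diffeomorphism phi phi_inv) (hphi2 : twice_differentiable phi)
  (hphi_affine : forall x p, phi (aug x p) = p *: alpha x + beta x)
  (hphi_origin : aug_x (phi_inv 0) = 0)
  (A : 'M[R]_(n + 1)) (B : 'M[R]_(n + 1, m.+1))
  (sigma' : 'cV[R]_(n + 1) -> 'M[R]_(n + 1, n))
  (gamma : 'cV[R]_(n + 1) -> 'cV[R]_(n + 1))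
  (fu : 'cV[R]_(n + 1) -> 'M[R]_m.+1) :
  let S := ControlSDE f g (fun x => diag_mx (\row_i sigma i x)) in
  transforms_to_semilinear S k phi phi_inv A B sigma' gamma fu ->
  forall P : 'M[R]_(n + 1),
  stochastic_clf (semilinear_sde A B sigma') (quadform P) ->
  let Vbar := fun (x : 'cV[R]_n) (p : R) => quadform P (phi (aug x p)) in
  exists V : 'cV[R]_n -> R,
    (forall x, exists2 p, V x = Vbar x p & forall q, V x <= Vbar x q) /\
    stochastic_clf S V.
Proof.
move=> S trans P [_ P_pd P_clf] Vbar.
have [phiK phi_invK _ _] := hphi.
pose V := min_state alpha beta P; pose pmin := argmin_state alpha beta P.
have min_le := min_state_le phiK hphi_affine P_pd.
exists V; split=> [x|].
  by exists (pmin x); [exact: (min_stateE phiK hphi_affine P_pd) | exact: min_le].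
split.
- exact: (twice_differentiable_min phiK hphi2 hphi_affine P_pd).
- exact: (positive_definite_min phiK phi_invK hphi_affine hphi_origin P_pd).
move=> x x0 Lg0 u.
pose xb := aug x (pmin x); pose z := phi xb; pose Sb := augmented_sde S.
have z0 : z != 0 by exact: (phi_aug_neq0 phiK hphi_origin).
have xbx : aug_x xb = x by rewrite /aug_x col_mxKu.
have gradE : grad (quadform P) z *m jac phi xb = row_mx (grad V x) 0.
  by rewrite -grad_quadform_comp//; exact: (grad_min phiK hphi2 hphi_affine P_pd).
have := trans z; rewrite /z phiK -/z -/Sb => -[fu_rank sigmaE inputE].
(* The hypothesis [Lg0] removes the columns of [u], and the zero last component of the gradient
   removes the column of [pdot]. *)
have gradB0 ub : grad (quadform P) z *m jac phi xb *m (input Sb xb *m ub) = 0.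
  rewrite gradE/= xbx mulmxA mul_row_block !mulmx0 !mul0mx addr0.
  have -> : grad V x *m g x = 0 by exact: Lg0.
  by rewrite addr0 row_mx0 mul0mx.
(* Fixing [u k 0] at [aug_p xb] leaves the reduced input free, so the splitting of the control term
   can be tested on every [w]; [w = 0] then isolates the [gamma] term. *)
have split_input w : grad (quadform P) z *m (aug_p xb *: gamma xb) +
    grad (quadform P) z *m B *m (fu xb *m w) = 0.
  have [v [pdot [vk <-]]] := reduced_input_surj k (aug_p xb) w.
  have [_ /(congr1 (mulmx (grad (quadform P) z)))] := inputE v pdot vk.
  by rewrite mulmxA gradB0 mulmxDr -mulmxA => <-.
have gamma0 : grad (quadform P) z *m (aug_p xb *: gamma xb) = 0.
  by have := split_input 0; rewrite !mulmx0 addr0.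
have LgB0 : grad (quadform P) z *m B = 0.
  have fu_unit : fu xb \in unitmx by rewrite -row_free_unit /row_free fu_rank.
  rewrite -[LHS](mulmxK fu_unit); apply/eqP.
  rewrite (_ : _ *m fu xb = 0) ?mul0mx//; apply/rowP => j.
  (* Basis vectors show that the gradient times [B *m fu xb] vanishes column by column;
     invertibility of [fu xb] cancels that factor. *)
  have := split_input (delta_mx j 0).
  by rewrite gamma0 add0r mulmxA -colE => /colP/(_ 0); rewrite !mxE.
have := P_clf z z0 LgB0 0.
rewrite /generator mulmx0 [in X in _ + X + _]mxE addr0.
rewrite /generator Lg0 mul0mx [in X in _ -> _ + X + _ < _]mxE addr0.
apply: le_lt_trans.
(* An input with zero reduced vector turns the drift identity into a formula for [A *m z]; its
   remaining control term is killed by [gradB0]. *)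
have [v [pdot [vk w0]]] := reduced_input_surj k (aug_p xb) 0.
have [/(congr1 (mulmx (grad (quadform P) z))) + _] := inputE v pdot vk.
rewrite w0 !mulmx0 addr0 mulmxDr => driftE.
have LfE : Lf (semilinear_sde A B sigma') (quadform P) z =
    Lf S V x + (grad (quadform P) z *m tau phi (noise Sb) xb) 0 0.
  rewrite /Lf/= driftE mxE; congr (_ + _).
  rewrite (mulmxA _ (jac phi xb)) mulmxDr gradB0 addr0 gradE/= xbx.
  by rewrite mul_row_col mul0mx addr0.
(* The [tau] term of [LfE] and the Ito term at [z] add up to the Ito term of [quadform P \o phi] at
   [xb], which dominates that of [V] at [x]. *)
have := ito_term_min_le phiK hphi2 hphi_affine P_pd x (\row_i sigma i x).
have -> : col_mx (diag_mx (\row_i sigma i x)) 0 = noise Sb xb by rewrite /= xbx.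
by rewrite (ito_term_quadform_comp _ hphi2) LfE -addrA lerD2l /= sigmaE.
Qed.
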